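(* Let $K$ be a field and let $I$ be a monomial ideal of $S=K[x_1,\dots,x_n]$ that is an M-cone ideal. Then $I$ is a Lyubeznik ideal. Furthermore, the Lyubeznik resolution of $I$ is minimal under any total order $\prec$ on $G(I)$ in which each c-inner point is less than the other elements of $G(I)$ (that is, every c-inner point is less than every element of $G(I)$ that is not a c-inner point).
   Context: For a monomial ideal $I$, $G(I)$ is its minimal set of monomial generators. For $A\subseteq G(I)$, the multidegree $m(A)$ is the least common multiple of the elements of $A$. A subset $C\subseteq G(I)$ is a cover of $u\in C$ if $u\mid m(C\setminus\{u\})$; $C$ is a cover if it is a cover of some $u\in C$. The complete cover induced by a cover $C$ is $\overline{C}=\{w\in G(I): w\mid m(C)\}$; a complete cover is a set of this form. A cover $C$ is M-minimal if there is no cover $V\subseteq G(I)$ whose multidegree $m(V)$ is a proper factor of $m(C)$. An M-minimal complete cover is a complete cover that is M-minimal. For a cover $C$, an out set of $C$ is a subset $D\subseteq C$ with $m(D)=m(C)$ such that no proper subset of $D$ has multidegree $m(D)$. An inner point of $C$ is a point of $C$ lying in no out set of $C$. An element $u\in G(I)$ is a c-inner point if for every cover $C$, either $u\notin C$ or $u$ is an inner point of $C$. $I$ is an M-cone ideal if every M-minimal complete cover contains a c-inner point. Let $\prec$ be a total order on $G(I)$, and let $\min$ denote least element under $\prec$. The Lyubeznik simplicial complex $L_{(I,\prec)}$ is the simplicial complex on $G(I)$ whose faces are the $F\subseteq G(I)$ such that for every nonempty $G\subseteq F$, $\min\{u\in G(I): u\mid m(G)\}\in G$. The Lyubeznik resolution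 of $I$ under $\prec$ is the free resolution $\cdots\to L_2\xrightarrow{\varphi_1}L_1\xrightarrow{\varphi_0}I\to0$, where $L_i$ is the free $S$-module with basis the faces $F\in L_{(I,\prec)}$ with $|F|=i$, $\varphi_0(\{u\})=u$, and for a face $F=\{u_{j_1}\prec\cdots\prec u_{j_i}\}$ with $i\ge2$, $\varphi_{i-1}(F)=\sum_{k=1}^{i}(-1)^{k+1}\frac{m(F)}{m(G_k)}G_k$ with $G_k=F\setminus\{u_{j_k}\}$. It is known that this is a free resolution of $I$. It is minimal if $\varphi_{i-1}(L_i)\subseteq(x_1,\dots,x_n)L_{i-1}$ for all $i\ge2$. $I$ is a Lyubeznik ideal if there is a total order on $G(I)$ such that the corresponding Lyubeznik resolution of $I$ is minimal. *)

(* Defs.v *)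
From Stdlib Require Import Classical ClassicalEpsilon.
From HB Require Import structures.
From mathcomp Require Import all_boot all_order all_algebra.
From mathcomp Require Import finmap.
From mathcomp Require Import mpoly.

Set Implicit Arguments.
Unset Strict Implicit.
Unset Printing Implicit Defensive.

Import GRing.Theory.
Local Open Scope ring_scope.

Lemma mlcmA n : associative (@mlcm n).
Proof. by move=> a b c; apply/mnmP=> i; rewrite !mnmE maxnA. Qed.

HB.instance Definition _ n :=
  Monoid.isComLaw.Build 'X_{1..n} 0%MM (@mlcm n) (@mlcmA n) (@mlcmC n) (@mlc0m n).

(* Subsets of a ring, and in particular ideals, are Prop-valued predicates. *)

Definition ideal_gen (R : comNzRingType) (X : R -> Prop) (p : R) : Prop :=
  exists s : seq (R * R),
    (forall a, a \in s -> X a.2) /\ p = \sum_(a <- s) a.1 * a.2.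

(* The submodule J L of L. *)
Definition ideal_smul (R : comNzRingType) (L : lmodType R) (J : R -> Prop)
    (y : L) : Prop :=
  exists s : seq (R * L),
    (forall a, a \in s -> J a.1) /\ y = \sum_(a <- s) a.1 *: a.2.

Definition irrelevant_ideal (K : fieldType) (n : nat) : {mpoly K[n]} -> Prop :=
  ideal_gen (fun p => exists i : 'I_n, p = 'X_i).

Section MonomialIdeals.
Variables (K : fieldType) (n : nat).
Implicit Types (I : {mpoly K[n]} -> Prop) (G H : {fset 'X_{1..n}}).

Definition mono_gen (M : 'X_{1..n} -> Prop) : {mpoly K[n]} -> Prop :=
  ideal_gen (fun p => exists2 m, M m & p = 'X_[m]).

(* Ideals generated by a possibly infinite set of monomials; the zero ideal and
   the whole ring are included. *)
Definition monomial_ideal I : Prop :=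
  exists M : 'X_{1..n} -> Prop, forall p, I p <-> mono_gen M p.

Definition generates I G : Prop :=
  forall p, I p <-> mono_gen (fun m => m \in G) p.

Definition is_mingens I G : Prop :=
  generates I G /\ forall H, (H `<` G)%fset -> ~ generates I H.

(* G(I), characterised for monomial ideals by [mingensP] and
   [is_mingens_unique] below. *)
Definition mingens I : {fset 'X_{1..n}} :=
  epsilon (inhabits fset0) (is_mingens I).

Lemma mono_gen_X (M : 'X_{1..n} -> Prop) m m' :
  M m' -> (m' <= m)%MM -> mono_gen M 'X_[m].
Proof.
move=> Mm' le_m'm; exists [:: ('X_[m - m'], 'X_[m'])]; split.
  by move=> a; rewrite inE => /eqP->; exists m'.
by rewrite big_seq1 -mpolyXD submK.
Qed.

Lemma mono_gen_sub (M M' : 'X_{1..n} -> Prop) :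
  (forall m, M m -> exists2 m', M' m' & (m' <= m)%MM) ->
  forall p, mono_gen M p -> mono_gen M' p.
Proof.
move=> sub p [s [Ms ->]]; elim: s Ms => [|[a q] s IHs] Ms.
  by exists [::]; split=> //; rewrite !big_nil.
have [|t [Mt Et]] := IHs; first by move=> b sb; apply: Ms; rewrite inE sb orbT.
have [|m Mm /= ->] := Ms (a, q); first by rewrite inE eqxx.
have [m' Mm' le_m'm] := sub m Mm.
exists ((a * 'X_[m - m'], 'X_[m']) :: t); split.
  by move=> b; rewrite inE => /orP[/eqP->|/Mt //]; exists m'.
by rewrite !big_cons -Et /= -mulrA -mpolyXD submK.
Qed.

Lemma mono_genX (M : 'X_{1..n} -> Prop) m :
  mono_gen M 'X_[m] -> exists2 m', M m' & (m' <= m)%MM.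
Proof.
case=> s [Ms Em]; apply: NNPP => noM.
have: ('X_[m] : {mpoly K[n]})@_m = 0.
  rewrite Em raddf_sum big_seq big1 //= => -[a q] /Ms [m' Mm' /= ->].
  apply/memN_msupp_eq0; rewrite (perm_mem (msuppMX a m')).
  by apply/mapP=> -[k _ Dm]; apply: noM; exists m'; rewrite // Dm lem_addr.
by rewrite mcoeffX eqxx => /eqP; rewrite oner_eq0.
Qed.

Lemma dickson (M : 'X_{1..n} -> Prop) :
  exists s : seq 'X_{1..n}, (forall m, m \in s -> M m) /\
    forall m, M m -> exists2 g, g \in s & (g <= m)%MM.
Proof.
suff /(_ n (leqnn n) M)[s [Ms Ds]]: forall k, (k <= n)%N ->
    forall M : 'X_{1..n} -> Prop,
    exists s : seq 'X_{1..n}, (forall m, m \in s -> M m) /\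
      forall m, M m ->
        exists2 g, g \in s & forall i : 'I_n, (i < k)%N -> (g i <= m i)%N.
  exists s; split=> // m /Ds[g sg le_gm]; exists g => //.
  by apply/mnm_lepP=> i; apply: le_gm.
clear M; elim=> [|k IHk] lt_kn M.
  have [[m Mm]|noM] := classic (exists m, M m).
    by exists [:: m]; split=> [m'|m' _]; [rewrite inE => /eqP-> | exists m; rewrite ?inE].
  by exists [::]; split=> // m Mm; case: noM; exists m.
pose k' := Ordinal lt_kn.
have [s [Ms Ds]] := IHk (ltnW lt_kn) M.
pose N := (\max_(g <- s) g k')%N.
have [t [Mt Dt]]: exists t : seq 'X_{1..n}, (forall m, m \in t -> M m) /\
    forall m, M m -> (m k' < N)%N ->
      exists2 g, g \in t & forall i : 'I_n, (i < k.+1)%N -> (g i <= m i)%N.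
  elim: N => [|N [t [Mt Dt]]]; first by exists [::].
  have [u [Mu Du]] := IHk (ltnW lt_kn) (fun m => M m /\ m k' = N).
  exists (t ++ u); split=> [m|m Mm].
    by rewrite mem_cat => /orP[/Mt|/Mu[]].
  rewrite ltnS leq_eqVlt => /orP[/eqP DN|/(Dt m Mm)[g tg le_gm]]; last first.
    by exists g; rewrite // mem_cat tg.
  have [g ug le_gm] := Du m (conj Mm DN); exists g; first by rewrite mem_cat ug orbT.
  move=> i; rewrite ltnS leq_eqVlt => /orP[/eqP Di|/le_gm //].
  have -> : i = k' by apply: val_inj.
  by rewrite (Mu g ug).2 DN.
exists (s ++ t); split=> [m|m Mm].
  by rewrite mem_cat => /orP[/Ms|/Mt].
have [lt_mN|le_Nm] := ltnP (m k') N.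
  by have [g tg le_gm] := Dt m Mm lt_mN; exists g; rewrite // mem_cat tg orbT.
have [g sg le_gm] := Ds m Mm; exists g; first by rewrite mem_cat sg.
move=> i; rewrite ltnS leq_eqVlt => /orP[/eqP Di|/le_gm //].
have -> : i = k' by apply: val_inj.
apply: leq_trans le_Nm; exact: (@leq_bigmax_seq _ s xpredT (fun g : 'X_{1..n} => g k') g).
Qed.

Lemma mingens_exists I : monomial_ideal I -> exists G, is_mingens I G.
Proof.
case=> M IM; have [s [Ms Ds]] := dickson M.
have: generates I [fset m in s]%fset.
  move=> p; rewrite IM; split; apply: mono_gen_sub => m.
    by move=> /Ds[g sg le_gm]; exists g; rewrite // inE.
  by rewrite inE => /Ms Mm; exists m; rewrite ?lepm_refl.
move: [fset m in s]%fset => G; have [k] := ubnP #|` G|.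
elim: k G => // k IHk G; rewrite ltnS => leGk genG.
have [[H [ltHG genH]]|minG] := classic (exists H, (H `<` G)%fset /\ generates I H).
  by apply: (IHk H) genH; apply: leq_trans leGk; apply: fproper_ltn_card.
by exists G; split=> // H ltHG genH; apply: minG; exists H.
Qed.

Lemma mingensP I : monomial_ideal I -> is_mingens I (mingens I).
Proof. by move=> /mingens_exists; apply: epsilon_spec. Qed.

Lemma mingens_antichain I G m m' : is_mingens I G ->
  m \in G -> m' \in G -> (m <= m')%MM -> m = m'.
Proof.
move=> [genG minG] Gm Gm' le_mm'; apply/eqP; apply: contraT => ne_mm'.
case: (minG (G `\ m')%fset); first exact: fproperD1.
move=> p; rewrite genG; split; apply: mono_gen_sub => g.
  have [->|ne_gm'] := eqVneq g m'; first by exists m; rewrite // in_fsetD1 ne_mm'.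
  by move=> Gg; exists g; rewrite ?lepm_refl // in_fsetD1 ne_gm'.
by rewrite in_fsetD1 => /andP[_ Gg]; exists g; rewrite ?lepm_refl.
Qed.

Lemma is_mingens_unique I G H : is_mingens I G -> is_mingens I H -> G = H.
Proof.
have sub G1 G2 : is_mingens I G1 -> is_mingens I G2 -> (G1 `<=` G2)%fset.
  move=> minG1 minG2; apply/fsubsetP=> m G1m.
  have /mono_genX[m2 G2m2 le2]: mono_gen (fun u => u \in G2) ('X_[m] : {mpoly K[n]}).
    by apply/minG2.1/minG1.1/(mono_gen_X G1m); apply: lepm_refl.
  have /mono_genX[m1 G1m1 le1]: mono_gen (fun u => u \in G1) ('X_[m2] : {mpoly K[n]}).
    by apply/minG1.1/minG2.1/(mono_gen_X G2m2); apply: lepm_refl.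
  have Dm1 := mingens_antichain minG1 G1m1 G1m (lepm_trans le1 le2).
  suff -> : m = m2 by [].
  apply/mnmP=> i; apply/eqP; rewrite eqn_leq (mnm_lepP le2) andbT.
  by rewrite -Dm1 (mnm_lepP le1).
by move=> minG minH; apply/eqP; rewrite eqEfsubset !sub.
Qed.

End MonomialIdeals.

Section Covers.
Variables (n : nat) (G : {fset 'X_{1..n}}).
Implicit Types (A C D E F V : {set G}) (u v w : G).

Definition mlcm_set A : 'X_{1..n} := \big[@mlcm n/0%MM]_(u in A) val u.

Definition is_cover_of C u : bool :=
  (u \in C) && (val u <= mlcm_set (C :\ u))%MM.

Definition is_cover C : bool := [exists u, is_cover_of C u].

Definition cover_closure C : {set G} := [set w | (val w <= mlcm_set C)%MM].

Definition complete_cover D : bool :=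
  [exists C, is_cover C && (D == cover_closure C)].

Definition M_minimal C : bool :=
  is_cover C &&
  [forall V, ~~ [&& is_cover V, (mlcm_set V <= mlcm_set C)%MM
                  & mlcm_set V != mlcm_set C]].

Definition out_set C D : bool :=
  [&& D \subset C, mlcm_set D == mlcm_set C
    & [forall E : {set G}, (E \proper D) ==> (mlcm_set E != mlcm_set D)]].

Definition inner_point C u : bool :=
  (u \in C) && [forall D, out_set C D ==> (u \notin D)].

Definition c_inner_point u : bool :=
  [forall C, is_cover C ==> (u \notin C) || inner_point C u].

Definition M_cone : bool :=
  [forall D, complete_cover D && M_minimal D ==>
     [exists w, (w \in D) && c_inner_point w]].

End Covers.

Definition M_cone_ideal (K : fieldType) (n : nat) (I : {mpoly K[n]} -> Prop) :=
  M_cone (mingens I).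

(* A total order is given by its reflexive relation; the order written \prec
   in the literature is [strict le]. *)
Definition total_order (T : eqType) (le : rel T) : Prop :=
  [/\ reflexive le, antisymmetric le, transitive le & total le].

Definition strict (T : eqType) (le : rel T) : rel T :=
  fun u v => (u != v) && le u v.

Section Lyubeznik.
Variables (K : fieldType) (n : nat) (G : {fset 'X_{1..n}}) (le : rel G).
Implicit Types (A F : {set G}).

Definition least A (u : G) : bool := (u \in A) && [forall v in A, le u v].

Definition lyubeznik_face F : bool :=
  [forall A : {set G}, (A \subset F) && (A != set0) ==>
     [exists u in A, least [set w | (val w <= mlcm_set A)%MM] u]].

Lemma lyubeznik_face_sub A F : A \subset F -> lyubeznik_face F -> lyubeznik_face A.
Proof.
move=> sAF /forallP faceF; apply/forallP=> B; apply/implyP=> /andP[sBA B0].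
by have := faceF B; rewrite (subset_trans sBA sAF) B0.
Qed.

Definition lyubeznik_faces (i : nat) : finType :=
  {F : {set G} | lyubeznik_face F && (#|F| == i)}.

Definition lyubeznik_module (i : nat) : lmodType {mpoly K[n]} :=
  {ffun lyubeznik_faces i -> {mpoly K[n]}^o}.

(* The basis vector of L_i attached to A; it is 0 if A is not a face with i
   elements, but [lyubeznik_diff_face] only uses it on faces, by
   [lyubeznik_face_sub]. *)
Definition face_vec (i : nat) A : lyubeznik_module i :=
  [ffun F => (val F == A)%:R].

(* phi_i (F), for a face F with i + 1 elements. The element u_(j_k) of F has
   exactly k - 1 predecessors in F, and (-1)^(k - 1) = (-1)^(k + 1). *)
Definition lyubeznik_diff_face (i : nat) (F : lyubeznik_faces i.+1) :
    lyubeznik_module i :=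
  \sum_(u in val F)
    ((-1) ^+ #|[set v in val F | strict le v u]| *
       'X_[mlcm_set (val F) - mlcm_set (val F :\ u)]) *: face_vec i (val F :\ u).

(* phi_i : L_(i + 1) -> L_i, of use for i >= 1. *)
Definition lyubeznik_diff (i : nat) (x : lyubeznik_module i.+1) :
    lyubeznik_module i :=
  \sum_(F : lyubeznik_faces i.+1) x F *: lyubeznik_diff_face F.

(* phi_0 : L_1 -> I, with values in the ambient ring. Minimality puts no
   condition on it. *)
Definition lyubeznik_augmentation (x : lyubeznik_module 1) : {mpoly K[n]} :=
  \sum_(F : lyubeznik_faces 1) x F * 'X_[mlcm_set (val F)].

Definition lyubeznik_minimal : Prop :=
  forall i : nat, (1 <= i)%N -> forall x : lyubeznik_module i.+1,
    ideal_smul (@irrelevant_ideal K n) (lyubeznik_diff x).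

End Lyubeznik.

Definition lyubeznik_ideal (K : fieldType) (n : nat) (I : {mpoly K[n]} -> Prop) :=
  exists le : rel (mingens I), total_order le /\ lyubeznik_minimal K le.

(* Main.v *)
Require Import Defs.
From HB Require Import structures.
From mathcomp Require Import all_boot all_order all_algebra.
From mathcomp Require Import finmap.
From mathcomp Require Import mpoly.

Set Implicit Arguments.
Unset Strict Implicit.

(** Suppose a face [F] with at least two elements has a member [u] such that
    [m(F \ u) = m(F)], so that [F] is a cover.  A cover of minimal multidegree
    among those whose multidegree divides [m(F)] has an M-minimal closure, so
    some c-inner point divides [m(F)], and the least generator [w] dividing
    [m(F)] is a c-inner point.  As [F] is a face, [w] lies in [F], and it is
    therefore outside every out set [D] of [F].  But [m(D) = m(F)], so [w] is
    also the least generator dividing [m(D)], and the face condition for [D]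
    forces [w] into [D]. *)

Import GRing.Theory.

Section Multidegrees.
Context {n : nat}.
Implicit Types (m : 'X_{1..n}).

Lemma lepm_anti m m' : (m <= m')%MM -> (m' <= m)%MM -> m = m'.
Proof.
move=> /mnm_lepP le_mm' /mnm_lepP le_m'm; apply/mnmP=> i.
by apply/eqP; rewrite eqn_leq le_mm' le_m'm.
Qed.

(** Lets a cover of minimal multidegree be found by minimizing a natural number. *)
Lemma ltn_mdeg m m' : (m <= m')%MM -> m != m' -> mdeg m < mdeg m'.
Proof.
move=> le_mm'; apply: contraNltn => le_deg.
have Dm' := submK le_mm'; rewrite -Dm' mdegD -{2}[mdeg m]add0n leq_add2r in le_deg.
by move: le_deg Dm'; rewrite leqn0 mdeg_eq0 => /eqP-> <-; rewrite add0m.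
Qed.

End Multidegrees.

Section Covers.
Context {n : nat} {G : {fset 'X_{1..n}}}.
Implicit Types (A B C D F V : {set G}) (u v w : G) (le : rel G).

Lemma mlcm_set_lepP A m :
  reflect (forall u, u \in A -> (val u <= m)%MM) (mlcm_set A <= m)%MM.
Proof.
have -> : (mlcm_set A <= m)%MM = [forall u in A, (val u <= m)%MM].
  rewrite /mlcm_set -big_andE; elim/big_rec2: _ => [|u b k _ <-].
    by apply/mnm_lepP=> i; rewrite mnmE.
  by rewrite lem_mlcm.
exact: forall_inP.
Qed.

Lemma lepm_mlcm_set A u : u \in A -> (val u <= mlcm_set A)%MM.
Proof. by apply/mlcm_set_lepP; apply: lepm_refl. Qed.

Lemma mlcm_setS A B : A \subset B -> (mlcm_set A <= mlcm_set B)%MM.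
Proof.
by move=> /subsetP sAB; apply/mlcm_set_lepP=> u /sAB; apply: lepm_mlcm_set.
Qed.

Lemma is_coverS C D : C \subset D -> is_cover C -> is_cover D.
Proof.
move=> sCD /existsP[u /andP[Cu le_u]]; apply/existsP; exists u.
rewrite /is_cover_of (subsetP sCD) //=.
exact: lepm_trans le_u (mlcm_setS (setSD _ sCD)).
Qed.

Lemma sub_cover_closure C : C \subset cover_closure C.
Proof. by apply/subsetP=> u Cu; rewrite inE lepm_mlcm_set. Qed.

(** The closure adds only divisors of [m(C)], so closing a cover keeps its multidegree minimal. *)
Lemma mlcm_set_closure C : mlcm_set (cover_closure C) = mlcm_set C.
Proof.
apply: lepm_anti; last exact/mlcm_setS/sub_cover_closure.
by apply/mlcm_set_lepP=> u; rewrite inE.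
Qed.

Lemma M_cone_c_inner C : M_cone G -> is_cover C ->
  exists2 w : G, c_inner_point w & (val w <= mlcm_set C)%MM.
Proof.
move=> coneG covC.
pose P V := is_cover V && (mlcm_set V <= mlcm_set C)%MM.
have PC : P C by rewrite /P covC lepm_refl.
case: (arg_minnP (fun V => mdeg (mlcm_set V)) PC) => V /andP[covV le_VC] minV.
have /existsP[w /andP[Dw cw]] :
    [exists w, (w \in cover_closure V) && c_inner_point w].
  move/forallP/(_ (cover_closure V))/implyP: coneG; apply.
  rewrite /complete_cover /M_minimal (is_coverS (sub_cover_closure V)) //=.
  apply/andP; split; first by apply/existsP; exists V; rewrite covV eqxx.
  apply/forallP=> W; apply/negP; rewrite mlcm_set_closure.
  case/and3P=> covW le_WV ne_WV.
  (* A cover [W] strictly below [V] also divides [m(C)], so it competes in the minimization, yet its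
     degree is smaller. *)
  have /minV : P W by rewrite /P covW (lepm_trans le_WV).
  by rewrite leqNgt ltn_mdeg.
by exists w => //; move: Dw; rewrite inE => /lepm_trans; apply.
Qed.

(** Take [D] inclusion-minimal among the subsets of [C] with multidegree [m(C)]. *)
Lemma exists_out_set C : exists D, out_set C D.
Proof.
have [D /minsetP[/andP[sDC /eqP eq_DC] minD]] :
    {D | minset (fun D => (D \subset C) && (mlcm_set D == mlcm_set C)) D}.
  by apply: ex_minset; exists C; rewrite subxx eqxx.
exists D; rewrite /out_set sDC eq_DC eqxx; apply/forallP=> E; apply/implyP=> pED.
apply/negP=> eqE; have sED := proper_sub pED; move: pED; rewrite properE.
by rewrite (minD E) ?subxx ?andbF // (subset_trans sED).
Qed.

(** The face condition puts a least generator dividing [m(F)] in [F], and antisymmetry identifies it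
    with [w]. This serves both for a face and for its out set. *)
Lemma least_dvd_mem_face le F (w : G) : antisymmetric le -> lyubeznik_face le F ->
  F != set0 -> least le [set u | (val u <= mlcm_set F)%MM] w -> w \in F.
Proof.
move=> anti_le /forallP/(_ F); rewrite subxx /= => /implyP faceF F0.
have /existsP[u /andP[Fu /andP[Wu /forall_inP le_u]]] := faceF F0.
case/andP=> Ww /forall_inP le_w.
by rewrite (anti_le w u) // le_w ?le_u.
Qed.

Lemma face_least le F : lyubeznik_face le F -> F != set0 ->
  exists w, least le [set u | (val u <= mlcm_set F)%MM] w.
Proof.
move=> /forallP/(_ F); rewrite subxx /= => /implyP faceF /faceF.
by case/existsP=> w /andP[_ least_w]; exists w.
Qed.

(** Two distinct monomials cannot both divide 1. *)
Lemma mlcm_set_neq0 F : 1 < #|F| -> mlcm_set F != 0%MM.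
Proof.
case/card_gt1P=> u [v [Fu Fv]]; apply: contraNneq => F0; apply/eqP/val_inj.
have val0 w : w \in F -> val w = 0%MM.
  move/lepm_mlcm_set; rewrite F0 => le_w0.
  by apply: lepm_anti le_w0 _; apply/mnm_lepP=> i; rewrite mnmE.
by rewrite (val0 u Fu) (val0 v Fv).
Qed.

Lemma face_mlcm_setD1 le F u : M_cone G -> total_order le ->
  (forall v w : G, c_inner_point v -> ~~ c_inner_point w -> strict le v w) ->
  lyubeznik_face le F -> 1 < #|F| -> u \in F ->
  mlcm_set (F :\ u) != mlcm_set F.
Proof.
move=> coneG [_ anti_le _ _] le_c faceF gtF1 Fu; apply/eqP=> eq_m.
have covF : is_cover F.
  by apply/existsP; exists u; rewrite /is_cover_of Fu eq_m lepm_mlcm_set.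
have F0 : F != set0 by apply/set0Pn; exists u.
have [w least_w] := face_least faceF F0.
have Fw := least_dvd_mem_face anti_le faceF F0 least_w.
have cw : c_inner_point w.
  (* If [w] were not c-inner, the c-inner [v] dividing [m(F)] would strictly precede it, against the
     choice of [w]. *)
  have [v cv le_vF] := M_cone_c_inner coneG covF.
  apply: contraT => ncw; have /andP[ne_vw le_vw] := le_c v w cv ncw.
  case/andP: least_w => _ /forall_inP/(_ v); rewrite inE => /(_ le_vF) le_wv.
  by case/eqP: ne_vw; apply: anti_le; rewrite le_vw.
have [D outD] := exists_out_set F.
have /negP[] : w \notin D.
  move/forallP/(_ F): cw; rewrite covF Fw /= => /andP[_ /forallP/(_ D)].
  by rewrite outD.
case/and3P: outD => sDF /eqP eq_D _.
apply: (least_dvd_mem_face anti_le (lyubeznik_face_sub sDF faceF)).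
  (* The face condition speaks of nonempty subsets only; [D] is nonempty because the empty set has
     exponent [0], unlike [F]. *)
  apply: contraNneq (mlcm_set_neq0 gtF1) => D0.
  by rewrite -eq_D D0 /mlcm_set big_set0.
by rewrite eq_D.
Qed.

End Covers.

Section IdealSmul.
Local Open Scope ring_scope.

Lemma ideal_smul_sum (R : comNzRingType) (L : lmodType R) (J : R -> Prop)
    (T : Type) (r : seq T) (P : pred T) (F : T -> L) :
  (forall i, P i -> ideal_smul J (F i)) ->
  ideal_smul J (\sum_(i <- r | P i) F i).
Proof.
move=> JF; apply: big_ind => //; first by exists [::]; rewrite big_nil.
move=> _ _ [s [Js ->]] [t [Jt ->]]; exists (s ++ t); rewrite big_cat; split=> //.
by move=> a; rewrite mem_cat => /orP[/Js|/Jt].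
Qed.

Lemma ideal_smulZ (R : comNzRingType) (L : lmodType R) (J : R -> Prop) a (y : L) :
  J a -> ideal_smul J (a *: y).
Proof.
move=> Ja; exists [:: (a, y)]; rewrite big_seq1; split=> //.
by move=> b; rewrite inE => /eqP->.
Qed.

Lemma irrelevant_idealMX (K : fieldType) n (p : {mpoly K[n]}) (m : 'X_{1..n}) :
  m != 0%MM -> irrelevant_ideal (p * 'X_[m]).
Proof.
move=> m0; have [i mi] : exists i, m i != 0%N.
  apply/existsP; apply: contraR m0; rewrite negb_exists => /forallP m_0.
  by apply/eqP/mnmP=> i; rewrite mnmE; apply/eqP/negPn/m_0.
exists [:: (p * 'X_[m - U_(i)], 'X_i)]; split.
  by move=> a; rewrite inE => /eqP->; exists i.
by rewrite big_seq1 /= -mulrA -mpolyXD submK // lep1mP.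
Qed.

End IdealSmul.

(** The coefficients of the differential are, up to sign, the quotients [m(F) / m(F \ u)], which lie
    in the irrelevant ideal as soon as they differ from 1. *)
Lemma lyubeznik_minimal_of_lt (K : fieldType) n (G : {fset 'X_{1..n}})
    (le : rel G) :
  (forall (F : {set G}) u, lyubeznik_face le F -> 1 < #|F| -> u \in F ->
     mlcm_set (F :\ u) != mlcm_set F) ->
  lyubeznik_minimal K le.
Proof.
move=> neq_m i i_gt0 x; apply: ideal_smul_sum => F _.
rewrite scaler_sumr; apply: ideal_smul_sum => u Fu.
rewrite scalerA mulrA; apply/ideal_smulZ/irrelevant_idealMX.
have /andP[faceF /eqP cardF] := valP F.
have ne_u : mlcm_set (val F :\ u) != mlcm_set (val F).
  (* Here [F] has [i + 1] elements with [i] at least 1, hence at least two. *)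
  by apply: neq_m => //; rewrite cardF ltnS.
apply: contraNneq ne_u => sub0; apply/eqP.
by have := submK (mlcm_setS (subD1set (val F) u)); rewrite sub0 add0m.
Qed.

Lemma exists_total_order_first (T : finType) (c : pred T) :
  exists le : rel T, total_order le /\
    forall u v, c u -> ~~ c v -> strict le u v.
Proof.
(* The elements satisfying [c] come first; within each of the two classes the order is that of the
   enumeration. *)
exists (fun u v => if c u == c v then enum_rank u <= enum_rank v else c u).
split; last first.
  move=> u v cu ncv; rewrite /strict cu (negPf ncv) andbT.
  by apply: contraNneq ncv => <-.
split=> [u|u v|v u w|u v]; first by rewrite eqxx.
- rewrite eq_sym; case: (c u) (c v) => [] [] //=;
    by rewrite -eqn_leq => /eqP/ord_inj/enum_rank_inj.
- by case: (c u) (c v) (c w) => [] [] [] //=; apply: leq_trans.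
- by case: (c u) (c v) => [] [] //=; apply: leq_total.
Qed.

Theorem proposition5p4 (K : fieldType) (n : nat) (I : {mpoly K[n]} -> Prop)
    (hI : monomial_ideal I) (hM : M_cone_ideal I) :
  lyubeznik_ideal I /\
  forall le : rel (mingens I), total_order le ->
    (forall u v : mingens I, c_inner_point u -> ~~ c_inner_point v ->
       strict le u v) ->
    lyubeznik_minimal K le.
Proof.
have minimal (le : rel (mingens I)) : total_order le ->
    (forall u v : mingens I, c_inner_point u -> ~~ c_inner_point v ->
       strict le u v) -> lyubeznik_minimal K le.
  move=> le_total le_c; apply: lyubeznik_minimal_of_lt => F u.
  exact: face_mlcm_setD1.
split=> //.
have [le [le_total le_c]] :=
  exists_total_order_first (T := mingens I) (fun u => c_inner_point u).
by exists le; split=> //; apply: minimal.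
Qed.
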